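(* Let $N\in\mathbb{N}$, $n_1,\dots,n_N\in\mathbb{N}$, $n=\sum_{i=1}^N n_i$. Let $Q\in\mathbb{R}^{n\times n}$ satisfy $Q=Q^T\succ 0$ and have condition number $k_Q$, and let $\Gamma=\mathrm{diag}(\gamma_1 I_{n_1},\dots,\gamma_N I_{n_N})$. If $$\gamma_i\in\left(\frac{\sqrt{k_Q}-1}{\|Q\|_2\sqrt{k_Q}},\ \frac{\sqrt{k_Q}+1}{\|Q\|_2\sqrt{k_Q}}\right)\quad\text{for all } i\in\{1,\dots,N\},$$ then $\|I-\Gamma Q\|_2<1$.
   Context: $\|\cdot\|_2$ is the spectral (Euclidean operator) norm. For a symmetric positive definite matrix $Q$ with eigenvalues $\lambda_1(Q)\ge\dots\ge\lambda_n(Q)$, the (spectral) condition number is $k_Q:=\lambda_1(Q)/\lambda_n(Q)$. $I_{m}$ is the $m\times m$ identity matrix and $I=I_n$; $\gamma_1,\dots,\gamma_N$ are real scalars. *)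

(* Defs.v *)
From mathcomp Require Import all_boot all_order all_algebra.
From mathcomp Require Import all_classical reals.

Set Implicit Arguments.
Unset Strict Implicit.
Unset Printing Implicit Defensive.

Import Order.TTheory GRing.Theory Num.Theory.

Local Open Scope classical_set_scope.
Local Open Scope ring_scope.

(* MathComp (with MathComp-Analysis for the real numbers [R : realType]). *)

Definition enorm (R : realType) (n : nat) (x : 'cV[R]_n) : R :=
  Num.sqrt (\sum_(i < n) x i 0 ^+ 2).

(* The closed unit ball is used, rather than the unit sphere, so that the set
   is nonempty also in dimension 0. *)
Definition specnorm (R : realType) (m n : nat) (A : 'M[R]_(m, n)) : R :=
  sup [set enorm (A *m x) | x in [set x : 'cV[R]_n | enorm x <= 1]].

Definition posdefmx (R : realType) (n : nat) (Q : 'M[R]_n) : Prop :=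
  forall x : 'cV[R]_n, x != 0 -> 0 < (x^T *m Q *m x) 0 0.

(* s lists the eigenvalues of Q with (algebraic) multiplicity, in the order
   lambda_1 >= ... >= lambda_n. *)
Definition is_eigvals (R : realType) (n : nat) (Q : 'M[R]_n) (s : seq R) : Prop :=
  sorted >=%R s /\ char_poly Q = \prod_(a <- s) ('X - a%:P).

(* The list is unique when it exists ([eigvalsE]), and it exists for every
   symmetric Q by the spectral theorem; it is [::] when char_poly Q does not
   split over R. *)
Definition eigvals (R : realType) (n : nat) (Q : 'M[R]_n) : seq R :=
  xget [::] [set s | is_eigvals Q s].

Definition condnum (R : realType) (n : nat) (Q : 'M[R]_n) : R :=
  head 0 (eigvals Q) / last 0 (eigvals Q).

Lemma eigvalsE (R : realType) (n : nat) (Q : 'M[R]_n) (s : seq R) :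
  is_eigvals Q s -> eigvals Q = s.
Proof.
move=> sP; have [ss sE] := sP.
have [es eE] : is_eigvals Q (eigvals Q) by apply: (xgetI [::] (x := s)).
apply: (sorted_eq ge_trans ge_anti es ss).
by apply: prod_XsubC_eq; rewrite -eE sE.
Qed.

(* Main.v *)
(* Write L = |Q|, mu for the least eigenvalue and y = Q x, so that k_Q = L / mu
   and the hypothesis reads (1 - L gamma_i)^2 < mu / L.  Split
   x - Gamma y = (x - y / L) + (1 / L - Gamma) y and pick t < mu / L above all
   the (1 - L gamma_i)^2: coordinatewise, (u + v)^2 <= u^2 / (1 - t) + v^2 / t
   bounds the squared norm by |x - y / L|^2 / (1 - t) + theta |y / L|^2 with
   theta < 1.  Since the spectrum of Q / L lies in [t, 1], the first term is at
   most |x|^2 - |y / L|^2, and |y / L| >= (mu / L) |x| gives a uniform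
   contraction factor.  Taking t strictly below mu / L <= 1 also covers k_Q = 1. *)

Require Import Defs.
From mathcomp Require Import all_boot all_order all_algebra.
From mathcomp Require Import all_classical reals.
From mathcomp Require Import spectral sesquilinear complex ring lra.

Set Implicit Arguments.
Unset Strict Implicit.
Unset Printing Implicit Defensive.

Import Order.TTheory GRing.Theory Num.Theory.

Local Open Scope ring_scope.

(** * Spectral decomposition of a real symmetric matrix *)

Lemma char_poly_conj (F : fieldType) n (P A : 'M[F]_n) : P \in unitmx ->
  char_poly (invmx P *m A *m P) = char_poly A.
Proof.
move=> Pu; rewrite /char_poly /char_poly_mx.
have PVP : map_mx polyC (invmx P) *m map_mx polyC P = 1%:M.
  by rewrite -map_mxM mulVmx // map_mx1.
have -> : 'X%:M - map_mx polyC (invmx P *m A *m P) =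
    map_mx polyC (invmx P) *m ('X%:M - map_mx polyC A) *m map_mx polyC P.
  rewrite !map_mxM mulmxBr mulmxBl; congr (_ - _).
  by rewrite scalar_mxC -mulmxA PVP mulmx1.
rewrite !det_mulmx mulrAC -det_mulmx PVP det1; exact: mul1r.
Qed.

(* The [w i] are the squared moduli of the coordinates of [x] in a complex
   orthonormal eigenbasis of [Q]. *)
Lemma symmetric_spectral (R : rcfType) n (Q : 'M[R]_n) : Q = Q^T ->
  exists2 d : 'I_n -> R, char_poly Q = \prod_i ('X - (d i)%:P)
  & forall x : 'cV[R]_n, exists w : 'I_n -> R,
    [/\ forall i, 0 <= w i,
        (x^T *m x) 0 0 = \sum_i w i,
        (x^T *m (Q *m x)) 0 0 = \sum_i d i * w i &
        ((Q *m x)^T *m (Q *m x)) 0 0 = \sum_i d i ^+ 2 * w i].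
Proof.
(* The complex spectral theorem is applied to [Q] read as a Hermitian matrix. Its eigenvalues are
   real, so the identities can be pulled back along the injection [f]. *)
move=> Qsym; pose f := real_complex R; pose A := map_mx f Q.
have fC (a : R) : (f a)^* = f a by exact: conjc_real.
have Areal : A \is a mxOver Num.real.
  by apply/mxOverP => i j; rewrite mxE; apply/CrealP.
have Asym : A \is symmetricmx.
  apply/is_hermitianmxP; rewrite expr0 scale1r map_mx_id // /A {1}Qsym.
  by rewrite map_trmx.
have Aherm := realsym_hermsym Asym Areal.
have Dreal := hermitian_spectral_diag_real Aherm.
have /orthomx_spectralP := hermitian_normalmx Aherm.
have Pun := spectral_unitarymx A; have Pu := spectral_unit A.
move: Pun Pu Dreal; set P := spectralmx A; set D := spectral_diag A.
move=> Pun Pu Dreal Aeq.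
pose d i := complex.Re (D 0 i).
have dE i : D 0 i = f (d i) by rewrite /f RRe_real //; exact/mxOverP.
exists d.
  apply: (map_poly_inj f); rewrite map_char_poly -/A Aeq char_poly_conj //.
  rewrite char_poly_trig ?diag_mx_is_trig // rmorph_prod.
  apply: eq_bigr => i _; rewrite rmorphB /= map_polyX map_polyC /=.
  by rewrite mxE eqxx mulr1n dE.
move=> x; pose X := map_mx f x; pose z := P *m X.
pose w i := complex.Re (z i 0) ^+ 2 + complex.Im (z i 0) ^+ 2.
exists w.
have wE i : f (w i) = (z i 0)^* * z i 0 by rewrite /f add_Re2_Im2 normCKC.
have AX : map_mx f (Q *m x) = invmx P *m (diag_mx D *m z).
  by rewrite map_mxM -/A Aeq -!mulmxA.
have XV : X = invmx P *m z by rewrite /z mulmxA mulVmx // mul1mx.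
have PVE : invmx P = map_mx Num.conj P^T by rewrite invmx_unitary.
(* Since [u] is real and [P] unitary, the transpose of [u] is the conjugate transpose of
   [invmx P *m v]; in [dot] the resulting factor [P] cancels [invmx P]. *)
have trC (u : 'cV[R]_n) (v : 'cV_n) : map_mx f u = invmx P *m v ->
    map_mx f u^T = map_mx Num.conj v^T *m P.
  move=> /(congr1 (fun M => map_mx Num.conj M^T)).
  have PE : map_mx Num.conj (invmx P)^T = P.
    by rewrite PVE; apply/matrixP => i j; rewrite !mxE conjCK.
  rewrite trmx_mul map_mxM PE => <-.
  by apply/matrixP => i j; rewrite !mxE fC.
have dot (u v : 'cV[R]_n) (u' v' : 'cV_n) :
    map_mx f u = invmx P *m u' -> map_mx f v = invmx P *m v' ->
    f ((u^T *m v) 0 0) = \sum_i (u' i 0)^* * v' i 0.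
  move=> /trC uE vE.
  have -> : f ((u^T *m v) 0 0) = (map_mx f (u^T *m v)) 0 0 by rewrite [RHS]mxE.
  rewrite map_mxM uE vE -mulmxA [P *m _]mulmxA mulmxV // mul1mx mxE.
  by apply: eq_bigr => i _; rewrite !mxE.
have Dz i : (diag_mx D *m z) i 0 = f (d i) * z i 0.
  by rewrite mul_diag_mx mxE dE.
split.
- by move=> i; rewrite addr_ge0 ?sqr_ge0.
- apply: (@complexI R); rewrite -/f (dot _ _ _ _ XV XV) /f rmorph_sum.
  by apply: eq_bigr => i _; rewrite -wE.
- apply: (@complexI R); rewrite -/f (dot _ _ _ _ XV AX) /f rmorph_sum.
  by apply: eq_bigr => i _; rewrite Dz rmorphM /= -/f wE mulrCA.
- apply: (@complexI R); rewrite -/f (dot _ _ _ _ AX AX) /f rmorph_sum.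
  apply: eq_bigr => i _; rewrite Dz [RHS]rmorphM [in RHS]rmorphXn /= -/f wE.
  by rewrite rmorphM /= fC expr2 mulrACA.
Qed.

(** * Euclidean norm and spectral norm *)

Lemma enorm_sqr (R : realType) n (x : 'cV[R]_n) : enorm x ^+ 2 = (x^T *m x) 0 0.
Proof.
rewrite sqr_sqrtr ?sumr_ge0 // => [|i _]; last exact: sqr_ge0.
by rewrite mxE; apply: eq_bigr => i _; rewrite mxE expr2.
Qed.

Lemma enorm_ge0 (R : realType) n (x : 'cV[R]_n) : 0 <= enorm x.
Proof. exact: sqrtr_ge0. Qed.

Lemma enormZ (R : realType) n a (x : 'cV[R]_n) : enorm (a *: x) = `|a| * enorm x.
Proof.
rewrite -sqrtr_sqr -sqrtrM ?sqr_ge0 // mulr_sumr; congr Num.sqrt.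
by apply: eq_bigr => i _; rewrite mxE exprMn.
Qed.

Lemma enorm_gt0 (R : realType) n (x : 'cV[R]_n) : x != 0 -> 0 < enorm x.
Proof.
move=> x0; rewrite lt_def enorm_ge0 andbT; apply: contra x0.
rewrite -sqrf_eq0 enorm_sqr mxE psumr_eq0 => [|i _]; last first.
  by rewrite mxE -expr2 sqr_ge0.
move=> /allP xi0; apply/eqP/matrixP => i j; rewrite ord1 [RHS]mxE.
have := xi0 i (mem_index_enum _).
by rewrite mxE -expr2 sqrf_eq0 => /eqP.
Qed.

Lemma specnorm_le (R : realType) m n (A : 'M[R]_(m, n)) (q : R) : 0 <= q ->
  (forall x : 'cV_n, enorm (A *m x) <= q * enorm x) -> specnorm A <= q.
Proof.
move=> q0 Aq; apply: ge_sup.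
  exists (enorm (A *m 0)), 0 => //=.
  by rewrite -[0](scale0r 0) enormZ normr0 mul0r.
move=> _ [x /= x1 <-]; apply: (le_trans (Aq x)).
by rewrite ler_piMr.
Qed.

(** The crude bound [q] makes the set under the supremum bounded above; otherwise [sup] would be a
    default value. Rescaling [x] to norm 1 then gives the sharp bound. *)
Lemma le_specnorm (R : realType) m n (A : 'M[R]_(m, n)) (q : R) : 0 <= q ->
  (forall x : 'cV_n, enorm (A *m x) <= q * enorm x) ->
  forall x : 'cV_n, enorm (A *m x) <= specnorm A * enorm x.
Proof.
move=> q0 Aq x; have [x0|x0] := eqVneq (enorm x) 0.
  by have := Aq x; rewrite x0 !mulr0.
have xgt0 : 0 < enorm x by rewrite lt_def x0 enorm_ge0.
rewrite -ler_pdivrMr //.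
have -> : enorm (A *m x) / enorm x = enorm (A *m ((enorm x)^-1 *: x)).
  by rewrite -scalemxAr enormZ ger0_norm ?invr_ge0 ?enorm_ge0 // mulrC.
apply: ub_le_sup; last first.
  exists ((enorm x)^-1 *: x) => //=.
  by rewrite enormZ ger0_norm ?invr_ge0 ?enorm_ge0 // mulVf.
exists q => _ [y /= y1 <-]; apply: (le_trans (Aq y)).
by rewrite ler_piMr.
Qed.

(** * Extreme eigenvalues of a positive definite matrix *)

Lemma symmetric_eigenvector (F : fieldType) n (Q : 'M[F]_n) a : Q = Q^T ->
  root (char_poly Q) a -> exists2 v : 'cV_n, v != 0 & Q *m v = a *: v.
Proof.
(* [eigenvalueP] yields a row eigenvector, which symmetry of [Q] turns into a column. *)
move=> Qsym; rewrite -eigenvalue_root_char => /eigenvalueP[v vQ v0].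
exists v^T; first by rewrite -trmx0 (inj_eq trmx_inj).
by rewrite {1}Qsym -trmx_mul vQ linearZ.
Qed.

Lemma sorted_ge_last (R : realDomainType) (s : seq R) (x0 x : R) :
  sorted >=%R s -> x \in s -> last x0 s <= x.
Proof.
rewrite (sorted_pairwise ge_trans); case/lastP: s => // s y.
rewrite pairwise_rcons last_rcons mem_rcons inE => /andP[/allP sy _].
by move=> /predU1P[->//|/sy].
Qed.

(** [L] and [mu] are the extreme eigenvalues. The last inequality says that (L I - Q)(Q - t I) is
    positive semidefinite, which holds since (L - d)(d - t) >= 0 for every eigenvalue d. *)
Lemma posdef_spectrum (R : realType) n (Q : 'M[R]_n) : (0 < n)%N ->
  Q = Q^T -> posdefmx Q ->
  exists L mu : R, [/\ 0 < mu <= L, specnorm Q = L, condnum Q = L / mu &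
    forall x : 'cV_n,
      mu ^+ 2 * enorm x ^+ 2 <= enorm (Q *m x) ^+ 2 /\
      forall t, t <= mu ->
        enorm (Q *m x) ^+ 2 + L * t * enorm x ^+ 2
          <= (L + t) * (x^T *m (Q *m x)) 0 0].
Proof.
move=> n0 Qsym Qpos.
have [d Qd Qw] := symmetric_spectral Qsym.
pose s := sort >=%R (codom d).
have sP : is_eigvals Q s.
  split; first by apply: sort_sorted => a b; rewrite orbC le_total.
  by rewrite (perm_big _ (permEl (perm_sort _ _))) big_image.
have ds i : d i \in s by rewrite mem_sort codom_f.
have sd a : a \in s -> exists i, a = d i.
  by rewrite mem_sort => /codomP.
have ssort := sP.1.
rewrite /condnum (eigvalsE sP); move: ssort ds sd.
(* Positive dimension excludes the empty list, where [head] and [last] return the default 0. *)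
case: s {sP} => [|L s] /= ssort ds sd; first by have := ds (Ordinal n0).
have leL i : d i <= L.
  have := ds i; rewrite inE => /predU1P[->//|].
  by move/allP: (order_path_min ge_trans ssort); apply.
set mu := last L s.
have gemu i : mu <= d i := @sorted_ge_last _ (L :: s) L _ ssort (ds i).
have eigP i : exists2 v : 'cV_n, v != 0 & Q *m v = d i *: v.
  apply: symmetric_eigenvector => //.
  by rewrite Qd rootE horner_prod (bigD1 i) //= hornerXsubC subrr mul0r.
have mu0 : 0 < mu.
  have [i ->] := sd mu (mem_last _ _).
  have [v v0 vQ] := eigP i; have := Qpos v v0.
  by rewrite -mulmxA vQ -scalemxAr mxE -enorm_sqr pmulr_lgt0 // exprn_gt0 ?enorm_gt0.
have muL : mu <= L by exact: (@sorted_ge_last _ (L :: s) L _ ssort (mem_head _ _)).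
have L0 : 0 <= L by exact/ltW/(lt_le_trans mu0).
have QL (x : 'cV_n) : enorm (Q *m x) <= L * enorm x.
  rewrite -(@ler_pXn2r _ 2) ?nnegrE ?mulr_ge0 ?enorm_ge0 //.
  have [w [w0 xw _ yw]] := Qw x.
  rewrite exprMn !enorm_sqr xw yw mulr_sumr ler_sum // => i _.
  by rewrite ler_wpM2r // ler_sqr ?nnegrE // (le_trans (ltW mu0)).
exists L, mu; split => //; first by rewrite mu0.
  (* [QL] bounds the norm above; an eigenvector for [L] attains the bound. *)
  apply/le_anti/andP; split; first exact: specnorm_le.
  have [i iL] := sd L (mem_head _ _); have [v v0 vQ] := eigP i.
  have := le_specnorm L0 QL v.
  by rewrite vQ -iL enormZ ger0_norm // ler_pM2r // enorm_gt0.
move=> x; have [w [w0 xw xyw yw]] := Qw x; rewrite !enorm_sqr.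
rewrite xw xyw yw; split.
  rewrite mulr_sumr ler_sum // => i _.
  by rewrite ler_wpM2r // ler_sqr ?nnegrE // ?(le_trans (ltW mu0)) // ltW.
move=> t tmu; rewrite !mulr_sumr -big_split ler_sum //= => i _.
rewrite mulrA -mulrDl ler_wpM2r // -subr_ge0.
have -> : (L + t) * d i - (d i ^+ 2 + L * t) = (L - d i) * (d i - t) by ring.
by rewrite mulr_ge0 ?subr_ge0 // (le_trans tmu).
Qed.

(** * The contraction estimate *)

(** Convexity of the square with weights 1 - t and t, at the points u / (1 - t) and v / t. *)
Lemma sqrD_le_weighted (R : realFieldType) (u v t : R) : 0 < t < 1 ->
  (u + v) ^+ 2 <= u ^+ 2 / (1 - t) + v ^+ 2 / t.
Proof.
move=> /andP[t0 t1]; have s0 : 0 < 1 - t by rewrite subr_gt0.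
rewrite -subr_ge0.
have -> : u ^+ 2 / (1 - t) + v ^+ 2 / t - (u + v) ^+ 2 =
    (t * u - (1 - t) * v) ^+ 2 / ((1 - t) * t).
  by field; rewrite !gt_eqF.
by rewrite divr_ge0 ?sqr_ge0 // mulr_ge0 ?ltW.
Qed.

Lemma diag_step_contraction (R : realType) n (Q : 'M[R]_n) (g : 'rV[R]_n) :
  Q = Q^T -> posdefmx Q ->
  (forall i, g 0 i \in
     `] (Num.sqrt (condnum Q) - 1) / (specnorm Q * Num.sqrt (condnum Q)),
        (Num.sqrt (condnum Q) + 1) / (specnorm Q * Num.sqrt (condnum Q)) [) ->
  specnorm (1%:M - diag_mx g *m Q) < 1.
Proof.
(* In dimension 0 every vector has norm 0, so the spectral norm is at most 0. *)
move=> Qsym Qpos; have [n0|n0] := posnP n => [_|].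
  apply: (@le_lt_trans _ _ 0) => //; apply: specnorm_le => // x.
  rewrite mul0r /enorm big1 ?sqrtr0 // => i _.
  by have := leq_ltn_trans (leq0n i) (ltn_ord i); rewrite lt0n (introT eqP n0).
have [L [mu [/andP[mu0 muL] -> -> QP]]] := posdef_spectrum n0 Qsym Qpos.
have L0 : 0 < L := lt_le_trans mu0 muL.
set s := Num.sqrt _ => gP.
have s0 : 0 < s by rewrite sqrtr_gt0 divr_gt0.
have s2 : s ^+ 2 = L / mu by rewrite sqr_sqrtr // divr_ge0 // ltW.
pose r := mu / L; have r0 : 0 < r by rewrite divr_gt0.
have r1 : r <= 1 by rewrite ler_pdivrMr // mul1r.
pose h i := (1 - L * g 0 i) ^+ 2.
(* The two gaps between G L s and the endpoints s - 1, s + 1 are positive; their product is 1 - ((1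
   - L G) s)^2. *)
have hr i : h i < r.
  have := gP i; rewrite in_itv => /andP[/= g1 g2].
  rewrite ltr_pdivrMr ?mulr_gt0 // in g1; rewrite ltr_pdivlMr ?mulr_gt0 // in g2.
  have -> : r = (s ^+ 2)^-1 by rewrite s2 invf_div.
  rewrite -[ltRHS]mul1r ltr_pdivlMr ?exprn_gt0 // -exprMn -subr_gt0.
  set G := g 0 i in g1 g2 *.
  have -> : 1 - ((1 - L * G) * s) ^+ 2 = (s + 1 - G * (L * s)) * (G * (L * s) - (s - 1)).
    by ring.
  by rewrite mulr_gt0 ?subr_gt0.
(* A maximum over finitely many indices, so it stays strictly below [r]; the start value 0 is also
   below [r]. *)
pose e := \big[Num.max/0]_i h i.
have he i : h i <= e by exact: le_bigmax.
have er : e < r by exact: bigmax_lt.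
have e0 : 0 <= e by apply: le_trans (he (Ordinal n0)); exact: sqr_ge0.
pose t := (e + r) / 2.
have et : e < t by rewrite midf_lt.
have tr : t < r by rewrite midf_lt.
have t0 : 0 < t by exact: le_lt_trans et.
have t1 : t < 1 by exact: lt_le_trans r1.
(* The squared contraction factor: with a = |x|^2 and c = |y / L|^2, the final bound is a - (1 - e /
   t) c, where c >= r^2 a. *)
pose q := 1 - (1 - e / t) * r ^+ 2.
have et1 : e / t < 1 by rewrite ltr_pdivrMr // mul1r.
have r21 : r ^+ 2 <= 1 by rewrite exprn_ile1 // ltW.
have q0 : 0 <= q.
  have et0 : 0 <= e / t by rewrite divr_ge0 // ltW.
  rewrite subr_ge0; apply: mulr_ile1 => //; last by rewrite gerBl.
    by rewrite subr_ge0 ltW.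
  exact: sqr_ge0.
have q1 : q < 1 by rewrite gtrBl mulr_gt0 ?subr_gt0 ?exprn_gt0.
apply: (@le_lt_trans _ _ (Num.sqrt q)); last first.
  by rewrite -sqrtr1 ltr_sqrt.
apply: specnorm_le => [|x]; first exact: sqrtr_ge0.
rewrite -(@ler_pXn2r _ 2) ?nnegrE ?mulr_ge0 ?enorm_ge0 ?sqrtr_ge0 //.
rewrite exprMn (sqr_sqrtr q0).
have Ltmu : L * t <= mu by rewrite -ler_pdivlMl // mulrC ltW.
have [yx yP] := QP x; have b1 := yP 0 (ltW mu0); have b2 := yP _ Ltmu.
(* Making [y] opaque keeps [mxE] from expanding the product [Q *m x]. *)
have [y yE] : exists y, y = Q *m x by exists (Q *m x).
rewrite -yE in yx b1 b2.
have step : enorm ((1%:M - diag_mx g *m Q) *m x) ^+ 2 <=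
    (enorm x ^+ 2 - 2 * ((x^T *m y) 0 0 / L) + enorm y ^+ 2 / L ^+ 2) / (1 - t)
    + e / t * (enorm y ^+ 2 / L ^+ 2).
  rewrite !enorm_sqr mulmxBl mul1mx -mulmxA mul_diag_mx -yE.
  rewrite !mxE !(mulr_sumr, mulr_suml) -sumrB.
  rewrite -!big_split !(mulr_sumr, mulr_suml) -big_split ler_sum //= => j _.
  rewrite !mxE; set X := x j 0; set Y := y j 0.
  have -> : (X - g 0 j * Y) * (X - g 0 j * Y) =
      ((X - Y / L) + (1 - L * g 0 j) * (Y / L)) ^+ 2.
    by field; rewrite gt_eqF.
  apply: (le_trans (sqrD_le_weighted _ _ (t := t) _)); first by rewrite t0.
  apply: lerD.
    rewrite le_eqVlt; apply/orP; left; apply/eqP; field.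
    by rewrite !gt_eqF // subr_gt0.
  rewrite exprMn mulrAC -expr2 -expr_div_n ler_wpM2r ?sqr_ge0 //.
  by rewrite ler_pM2r ?invr_gt0 //; exact: he.
apply: (le_trans step).
set a := enorm x ^+ 2 in yx b1 b2 *; set b := _ / L; set c := _ / L ^+ 2.
have L2 : 0 < L ^+ 2 by rewrite exprn_gt0.
have ca : r ^+ 2 * a <= c.
  by rewrite expr_div_n mulrAC ler_pM2r ?invr_gt0.
have cb : c <= b.
  move: b1; rewrite mulr0 mul0r !addr0 => b1.
  rewrite /b ler_pdivlMr //.
  have -> : c * L = enorm y ^+ 2 / L by rewrite /c; field; rewrite gt_eqF.
  by rewrite ler_pdivrMr // mulrC.
(* This is [b2] divided by L^2. *)
have cab : c + t * a <= (1 + t) * b.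
  rewrite -(ler_pM2r L2) mulrDl divfK ?gt_eqF //.
  have -> : (1 + t) * b * L ^+ 2 = (L + L * t) * (x^T *m y) 0 0.
    by rewrite /b; field; rewrite gt_eqF.
  by apply: le_trans b2; rewrite lerD2l expr2; nra.
have t1' : 0 < 1 - t by rewrite subr_gt0.
(* Adding [cab] to 1 - t times [cb] gives a - 2 b + c <= (1 - t)(a - c). *)
apply: (@le_trans _ _ ((a - c) + e / t * c)).
  rewrite lerD2r ler_pdivrMr //; nra.
rewrite /q; nra.
Qed.

Theorem theorem1 (R : realType) (N : nat) (n_ : 'I_N -> nat)
  (Q : 'M[R]_(\sum_(i < N) n_ i)) (gamma : 'I_N -> R)
  (Qsym : Q = Q^T) (Qpos : posdefmx Q)
  (Hgamma : forall i : 'I_N,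
     gamma i \in `] (Num.sqrt (condnum Q) - 1) / (specnorm Q * Num.sqrt (condnum Q)),
                    (Num.sqrt (condnum Q) + 1) / (specnorm Q * Num.sqrt (condnum Q)) [) :
  specnorm (1%:M - (\mxdiag_(i < N) (gamma i)%:M) *m Q) < 1.
Proof.
(* The block matrix is an ordinary diagonal matrix, each entry being some [gamma i]. *)
have -> : \mxdiag_(i < N) (gamma i)%:M =
    diag_mx (\mxrow_(i < N) const_mx (gamma i)) :> 'M_(\sum_i n_ i).
  by rewrite diag_mxrow; apply: eq_mxdiag => i; rewrite diag_const_mx.
by apply: diag_step_contraction => // j; rewrite !mxE.
Qed.
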